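(* Let $\mathbb{K}$ be a non-Archimedean valued field with valuation $|\cdot|$, let $n\geq 2$ be an integer, and let $p(z)=c_0+c_1z+\cdots+c_{n-1}z^{n-1}+z^n\in\mathbb{K}[z]$ with $c_0\neq 0$. If $\lambda\in\mathbb{K}$ is a zero of $p$, then $$\frac{1}{|\lambda|}\leq 1$$ or $$\frac{1}{|\lambda|}\left|\frac{1}{\lambda}+\frac{c_1}{c_0}\right|\leq \max\left\{\frac{1}{|c_0|},\frac{|c_2|}{|c_0|},\dots,\frac{|c_{n-1}|}{|c_0|}\right\}.$$
   Context: A non-Archimedean valued field is a field $\mathbb{K}$ with a map $|\cdot|:\mathbb{K}\to[0,\infty)$ such that $|x|=0$ iff $x=0$, $|xy|=|x||y|$, and $|x+y|\leq\max\{|x|,|y|\}$ for all $x,y\in\mathbb{K}$. The terms $|c_i|/|c_0|$ in the maximum range over $2\leq i\leq n-1$ (so for $n=2$ the maximum is just $1/|c_0|$). *)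

(* Defs.v *)
From HB Require Import structures.
From mathcomp Require Import all_boot all_order all_algebra.
From mathcomp Require Import reals.

Set Implicit Arguments.
Unset Strict Implicit.
Unset Printing Implicit Defensive.

Import Order.TTheory GRing.Theory Num.Theory.
Local Open Scope ring_scope.

(* Multiplicative (rank one) absolute value with values in [0, +oo); the
   trivial absolute value is allowed and completeness is not required. *)
Record nonarch_valuation (R : realType) (K : fieldType) := NonarchValuation {
  nav_fun :> K -> R;
  nav_ge0 : forall x, 0 <= nav_fun x;
  nav_eq0 : forall x, nav_fun x = 0 <-> x = 0;
  nav_mul : forall x y, nav_fun (x * y) = nav_fun x * nav_fun y;
  nav_add : forall x y, nav_fun (x + y) <= Num.max (nav_fun x) (nav_fun y)
}.

(* Main.v *)
Require Import Defs.
From mathcomp Require Import all_boot all_order all_algebra.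
From mathcomp Require Import reals.
From mathcomp Require Import ring.

Set Implicit Arguments.
Unset Strict Implicit.
Unset Printing Implicit Defensive.

Import Order.TTheory GRing.Theory Num.Theory.
Local Open Scope ring_scope.

(** Since [c 0 != 0], the root [lambda] is nonzero.  Dividing the equation
    [p(lambda) = 0] by [c 0 * lambda ^+ 2] and isolating the terms of degree
    0 and 1 gives
      [1 / lambda * (1 / lambda + c 1 / c 0)
         = - (\sum_(2 <= i < n) c i / c 0 * lambda ^+ (i - 2)
              + lambda ^+ (n - 2) / c 0)].
    If the first alternative fails then [v lambda < 1], so each remaining
    power of [lambda] has absolute value at most 1, and the ultrametric
    inequality bounds the right-hand side by the largest of the absolute
    values of its coefficients. *)

Section NonarchValuationTheory.

Variables (R : realType) (K : fieldType) (v : nonarch_valuation R K).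

Lemma nav_neq0 x : x != 0 -> v x != 0.
Proof. by apply: contra_neq => /nav_eq0. Qed.

Lemma nav_gt0 x : x != 0 -> 0 < v x.
Proof. by move=> x0; rewrite lt_neqAle eq_sym nav_neq0 // nav_ge0. Qed.

Lemma nav1 : v 1 = 1.
Proof.
by apply: (mulfI (nav_neq0 (oner_neq0 K))); rewrite -nav_mul !mulr1.
Qed.

(** [v (-1)] is a nonnegative square root of [v 1 = 1]. *)
Lemma navN x : v (- x) = v x.
Proof.
suff vN1 : v (-1) = 1 by rewrite -mulN1r nav_mul vN1 mul1r.
apply/eqP; rewrite -(@pexpr_eq1 _ _ 2) ?nav_ge0 //.
by rewrite expr2 -nav_mul mulrNN mulr1 nav1.
Qed.

Lemma navV x : x != 0 -> v x^-1 = (v x)^-1.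
Proof.
move=> x0; apply: (mulfI (nav_neq0 x0)).
by rewrite -nav_mul !mulfV ?nav1 ?nav_neq0.
Qed.

Lemma nav_div x y : y != 0 -> v (x / y) = v x / v y.
Proof. by move=> y0; rewrite nav_mul navV. Qed.

Lemma navX x k : v (x ^+ k) = v x ^+ k.
Proof. by elim: k => [|k IHk]; rewrite ?nav1 // !exprS nav_mul IHk. Qed.

Lemma nav_mulX_le x y k : v y <= 1 -> v (x * y ^+ k) <= v x.
Proof.
by move=> y1; rewrite nav_mul navX ler_piMr ?nav_ge0 // exprn_ile1 ?nav_ge0.
Qed.

(** The ultrametric inequality for finite sums: balls about 0 are closed under
    addition.  The extra summand [y] keeps the statement valid for an empty
    sum, whose absolute value 0 need not be at most an arbitrary [B]. *)
Lemma nav_sum_le (I : eqType) (r : seq I) (F : I -> K) y (B : R) :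
  v y <= B -> (forall i, i \in r -> v (F i) <= B) ->
  v (\sum_(i <- r) F i + y) <= B.
Proof.
move=> yB; elim: r => [|i r IHr] FB; first by rewrite big_nil add0r.
rewrite big_cons -addrA (le_trans (nav_add _ _ _)) // ge_max FB ?mem_head //=.
by apply: IHr => j jr; apply: FB; rewrite inE jr orbT.
Qed.

End NonarchValuationTheory.

(** Dividing by [x ^+ 2] rather than by a higher power leaves only nonnegative
    powers of [x] on the right, which stay bounded when [x] is small. *)
Lemma root_eq_div (K : fieldType) n (c : nat -> K) (x : K) :
  (2 <= n)%N -> c 0%N != 0 -> x != 0 ->
  root (\sum_(0 <= i < n) c i *: 'X^i + 'X^n) x ->
  1 / x * (1 / x + c 1%N / c 0%N) =
  - (\sum_(2 <= i < n) c i / c 0%N * x ^+ (i - 2)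
     + (c 0%N)^-1 * x ^+ (n - 2)).
Proof.
move=> n2 c0 x0; rewrite /root hornerD hornerXn horner_sum.
rewrite big_ltn ?(ltnW n2) // big_ltn // !hornerZ !hornerXn expr0 expr1 mulr1.
under eq_bigr => i _ do rewrite hornerZ hornerXn.
have xE k : (2 <= k)%N -> x ^+ k = x ^+ 2 * x ^+ (k - 2).
  by move=> k2; rewrite -exprD subnKC.
have -> : \sum_(2 <= i < n) c i * x ^+ i =
    c 0%N * x ^+ 2 * \sum_(2 <= i < n) c i / c 0%N * x ^+ (i - 2).
  rewrite mulr_sumr; apply: eq_big_nat => i /andP[i2 _].
  by rewrite xE //; field.
rewrite (xE n) //.
set S := \sum_(_ <= i < _) _; set y := x ^+ (n - 2) => /eqP px0.
have /mulfI : c 0%N * x ^+ 2 != 0 by rewrite mulf_neq0 ?expf_neq0.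
apply; apply/eqP; rewrite -subr_eq0; apply/eqP; rewrite -[RHS]px0.
by field; rewrite c0 x0.
Qed.

Theorem theorem2p4 (R : realType) (K : fieldType) (v : nonarch_valuation R K)
    (n : nat) (hn : (2 <= n)%N) (c : nat -> K) (hc0 : c 0%N != 0)
    (p : {poly K}) (hp : p = \sum_(0 <= i < n) c i *: 'X^i + 'X^n)
    (lambda : K) (hlambda : root p lambda) :
  1 / v lambda <= 1 \/
  1 / v lambda * v (1 / lambda + c 1%N / c 0%N)
    <= \big[Num.max/(1 / v (c 0%N))]_(2 <= i < n) (v (c i) / v (c 0%N)).
Proof.
(* [p(0) = c 0] is nonzero. *)
have l0 : lambda != 0.
  apply: contraTneq hlambda => ->; rewrite hp /root hornerD hornerXn horner_sum.
  rewrite big_ltn ?(ltnW hn) // hornerZ hornerXn expr0 mulr1 expr0n.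
  rewrite gtn_eqF ?(ltnW hn) // addr0 big_nat big1 ?addr0 // => i /andP[i0 _].
  by rewrite hornerZ hornerXn expr0n gtn_eqF // mulr0.
have [l1|/ltW l1] := leP 1 (v lambda); [left | right].
  by rewrite div1r invf_le1 // nav_gt0.
rewrite hp in hlambda.
rewrite -[X in X / v lambda](nav1 v) -nav_div // -nav_mul.
rewrite (root_eq_div hn hc0 l0 hlambda) navN.
apply: nav_sum_le => [|i ir]; apply: le_trans (nav_mulX_le _ _ l1) _.
  by rewrite navV // div1r bigmax_ge_id.
rewrite nav_div //.
exact: (le_bigmax_seq _ _ xpredT (fun j => v (c j) / v (c 0%N)) ir isT).
Qed.
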